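(* Let $F_1,F_2,F_3$ be finite integral domains (i.e. finite fields) with $|F_i^*|=n_i$ for $i=1,2,3$ and $n_1\geq n_2\geq n_3$, and let $R=F_1\times F_2\times F_3$. Then $$\alpha(\Gamma(R))=n_1n_2+n_1n_3+\max\{n_1,\,n_2n_3\}.$$
   Context: $F^*=F\setminus\{0\}$. For a commutative ring $R$ with $1\neq 0$, $\Gamma(R)$ is the simple undirected graph whose vertices are the nonzero zero-divisors of $R$, two distinct vertices $x,y$ being adjacent iff $xy=0$. $\alpha(G)$ is the independence number of a graph $G$ (maximum size of a set of pairwise non-adjacent vertices). *)

(* Defs.v *)
From HB Require Import structures.
From mathcomp Require Import all_boot all_algebra.

Set Implicit Arguments.
Unset Strict Implicit.
Unset Printing Implicit Defensive.

Import GRing.Theory.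
Local Open Scope ring_scope.

(* The library has the ring and the finite-type structures on a product, but
   not their join. *)
HB.instance Definition _ (R1 R2 : finComNzRingType) :=
  Finite.on (R1 * R2)%type.

Record sgraph := SGraph {
  vertex :> finType;
  adj : rel vertex;
  adj_sym : symmetric adj;
  adj_irr : irreflexive adj
}.

Definition independent (G : sgraph) (A : {set G}) : bool :=
  [forall x in A, forall y in A, (x != y) ==> ~~ adj x y].

(* The empty set is independent, so the maximum is over a nonempty family. *)
Definition alpha (G : sgraph) : nat :=
  \max_(A : {set G} | independent A) #|A|.

Section ZeroDivisorGraph.

(* Only finite rings are considered, so that the vertices form a finType and
   the independence number is a natural number. *)
Variable R : finComNzRingType.

Definition zero_divisor : pred R :=
  fun x => [exists y : R, (y != 0) && (x * y == 0)].

Definition zdg_vertex : finType := {x : R | (x != 0) && zero_divisor x}.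

(* The condition x != y matters: a nilpotent x may satisfy x * x = 0, but the
   graph has no loops. *)
Definition zdg_adj : rel zdg_vertex :=
  fun x y => (x != y) && (val x * val y == 0).

Lemma zdg_adj_sym : symmetric zdg_adj.
Proof. by move=> x y; rewrite /zdg_adj eq_sym mulrC. Qed.

Lemma zdg_adj_irr : irreflexive zdg_adj.
Proof. by move=> x; rewrite /zdg_adj eqxx. Qed.

Definition zero_divisor_graph : sgraph := SGraph zdg_adj_sym zdg_adj_irr.

End ZeroDivisorGraph.

(* Main.v *)
(** Whether two elements of a product of three domains multiply to zero only
    depends on their supports, the subsets of {1, 2, 3} where they do not
    vanish: the product is zero iff the supports are disjoint. The vertices are
    the elements whose support is nonempty and proper, and an independent set
    meets at most one of the two classes attached to a support and its
    complement. Summing the larger class of each complementary pair gives the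
    upper bound. It is attained because the supports {1, 2}, {1, 3} and either
    of {1}, {2, 3} pairwise intersect. *)

Require Import Defs.
From HB Require Import structures.
From mathcomp Require Import all_boot all_algebra.
From mathcomp Require Import zify.

Set Implicit Arguments.
Unset Strict Implicit.
Unset Printing Implicit Defensive.

Import GRing.Theory.

Lemma card_neq0_gt0 (F : finIdomainType) : 0 < #|[set x : F | x != 0%R]|.
Proof. by apply/card_gt0P; exists 1%R; rewrite inE oner_eq0. Qed.

Lemma card_nonzero_eq (F : finIdomainType) (b : bool) :
  #|[set x : F | (x != 0%R) == b]|
  = if b then #|[set x : F | x != 0%R]| else 1.
Proof.
case: b; first by apply: eq_card => x; rewrite !inE eqb_id.
rewrite -(cards1 (0%R : F)); apply: eq_card => x.
by rewrite !inE eqbF_neg negbK.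
Qed.

(** The eight supports are grouped into complementary pairs, the grouping in which an independent
    set is bounded. *)
Lemma sum_bool3 (f : bool * bool * bool -> nat) :
  \sum_s f s
  = f (true, true, true) + f (false, false, false)
    + (f (true, false, false) + f (false, true, true))
    + (f (false, true, false) + f (true, false, true))
    + (f (false, false, true) + f (true, true, false)).
Proof.
have sum_pair (I J : finType) (g : I * J -> nat) :
    \sum_p g p = \sum_i \sum_j g (i, j).
  by rewrite pair_bigA; apply: eq_bigr => -[].
rewrite sum_pair (sum_pair _ _ (fun p => \sum_c f (p, c))) !big_bool /=.
lia.
Qed.

Definition compl3 (s : bool * bool * bool) : bool * bool * bool :=
  (~~ s.1.1, ~~ s.1.2, ~~ s.2).

Definition disjoint3 (s t : bool * bool * bool) : bool :=
  [&& ~~ (s.1.1 && t.1.1), ~~ (s.1.2 && t.1.2) & ~~ (s.2 && t.2)].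

Section Support.

Variables F1 F2 F3 : finIdomainType.

Local Notation R := (F1 * F2 * F3)%type.
Local Notation n1 := #|[set x : F1 | x != 0%R]|.
Local Notation n2 := #|[set x : F2 | x != 0%R]|.
Local Notation n3 := #|[set x : F3 | x != 0%R]|.

Definition supp (x : R) : bool * bool * bool :=
  (x.1.1 != 0%R, x.1.2 != 0%R, x.2 != 0%R).

(** Counts the elements of support [s]: a coordinate in the support is any nonzero element, a
    coordinate outside it can only be 0. *)
Definition weight (s : bool * bool * bool) : nat :=
  (if s.1.1 then n1 else 1) * (if s.1.2 then n2 else 1)
  * (if s.2 then n3 else 1).

Lemma card_supp s : #|[set x : R | supp x == s]| = weight s.
Proof.
case: s => [[a b] c]; rewrite /weight /= -!card_nonzero_eq -!cardsX.
by apply: eq_card => -[[x y] z]; rewrite !inE /= !xpair_eqE.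
Qed.

Lemma mul_eq0_supp (x y : R) :
  (x * y == 0)%R = disjoint3 (supp x) (supp y).
Proof.
case: x y => [[x1 x2] x3] [[y1 y2] y3].
rewrite /disjoint3 /supp /= !negb_and !negbK -!mulf_eq0.
by rewrite !xpair_eqE -andbA.
Qed.

Lemma eq0_supp (x : R) : (x == 0)%R = (supp x == (false, false, false)).
Proof.
case: x => [[x1 x2] x3].
by rewrite /supp !xpair_eqE /= !eqbF_neg !negbK.
Qed.

Lemma zero_divisor_supp (x : R) :
  zero_divisor x = (supp x != (true, true, true)).
Proof.
apply/existsP/idP => [[y /andP[]]|sx].
  rewrite eq0_supp mul_eq0_supp.
  by case: (supp x) (supp y) => [[[] []] []] [[[] []] []].
(* The annihilating witness is the idempotent supported on the complement of [supp x]; it is nonzero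
   because that support is proper. *)
pose e (F : finIdomainType) (b : bool) : F := if b then 0%R else 1%R.
have e0 (F : finIdomainType) b : (e F b != 0%R) = ~~ b.
  by case: b; rewrite /e ?eqxx ?oner_eq0.
move: sx; case sx: (supp x) => [[a b] c] abc.
exists (e F1 a, e F2 b, e F3 c).
rewrite eq0_supp mul_eq0_supp sx /supp /= !e0.
by case: a b c abc {sx} => [] [] [].
Qed.

Lemma vertex_supp (x : R) :
  ((x != 0)%R && zero_divisor x)
  = (supp x \notin [:: (false, false, false); (true, true, true)]).
Proof. by rewrite eq0_supp zero_divisor_supp !inE negb_or. Qed.

Local Notation G := (zero_divisor_graph R).

Definition supp_class (A : {set G}) s : {set G} :=
  [set v in A | supp (val v) == s].

Lemma card_sum_supp (A : {set G}) : #|A| = \sum_s #|supp_class A s|.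
Proof.
rewrite -sum1_card (partition_big (fun v : G => supp (val v)) xpredT) //=.
apply: eq_bigr => s _; rewrite -sum1_card.
by apply: eq_bigl => v; rewrite inE.
Qed.

Lemma card_supp_class_le (A : {set G}) s : #|supp_class A s| <= weight s.
Proof.
rewrite -card_supp -(card_imset _ val_inj) subset_leq_card //.
by apply/subsetP => _ /imsetP[v + ->]; rewrite !inE => /andP[].
Qed.

(** Vertices of complementary supports multiply to zero, so as soon as [A] contains one of support
    [s], its class at [compl3 s] is empty. *)
Lemma card_supp_class_compl (A : {set G}) s : independent A ->
  #|supp_class A s| + #|supp_class A (compl3 s)|
  <= maxn (weight s) (weight (compl3 s)).
Proof.
move=> /forallP indA.
have [->|[v]] := set_0Vmem (supp_class A s).
  by rewrite cards0 leq_max card_supp_class_le orbT.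
rewrite inE => /andP[vA /eqP sv].
suff -> : supp_class A (compl3 s) = set0.
  by rewrite cards0 addn0 leq_max card_supp_class_le.
apply/setP => w; rewrite !inE; apply/negP => /andP[wA /eqP sw].
have /forallP/(_ w) := implyP (indA v) vA.
have vw : v != w.
  apply/eqP => evw; move: sw; rewrite -evw sv.
  by case: (s) => [[[] []] []].
rewrite wA vw /= /zdg_adj vw /= mul_eq0_supp sv sw.
by case: (s) => [[[] []] []].
Qed.

Lemma supp_class_improper (A : {set G}) s :
  s \in [:: (false, false, false); (true, true, true)] ->
  supp_class A s = set0.
Proof.
move=> sP; apply/setP => v; rewrite !inE; apply/negP => /andP[_ /eqP sv].
by have := valP v; rewrite vertex_supp sv sP.
Qed.

(** The witness is the set of all vertices with support in [S]: intersecting supports give a nonzero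
    product. *)
Lemma alpha_ge_supp (S : seq (bool * bool * bool)) : uniq S ->
  all (fun s => all (fun t => ~~ disjoint3 s t) S) S ->
  (true, true, true) \notin S ->
  \sum_(s <- S) weight s <= alpha G.
Proof.
move=> uS /allP SI S1.
(* The hypothesis on pairs includes [s = t], and the empty support is disjoint from itself. *)
have S0 : (false, false, false) \notin S.
  by apply/negP => h; have /allP/(_ _ h) := SI _ h.
pose A : {set G} := [set v : G | supp (val v) \in S].
have indA : independent A.
  apply/forallP => v; apply/implyP; rewrite inE => vS.
  apply/forallP => w; apply/implyP; rewrite inE => wS.
  apply/implyP => vw; rewrite /= /zdg_adj vw /= mul_eq0_supp.
  by have /allP/(_ _ wS) := SI _ vS.
apply: leq_trans (leq_bigmax_cond (F := fun A : {set G} => #|A|) A indA).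
rewrite card_sum_supp big_uniq // [leqRHS](bigID (mem S)) /=.
apply: leq_trans (leq_addr _ _); apply: leq_sum => s sS.
rewrite -card_supp -(card_imset _ val_inj) subset_leq_card //.
(* Supports in [S] are nonempty and proper, so every ring element with such a support is a vertex
   and the whole class is counted. *)
apply/subsetP => x; rewrite inE => /eqP sx.
have vx : (x != 0)%R && zero_divisor x.
  rewrite vertex_supp sx !inE negb_or.
  by apply/andP; split; apply: contraTneq sS => ->.
apply/imsetP; exists (Sub x vx : G); last by rewrite SubK.
by rewrite !inE !SubK sx sS eqxx.
Qed.

End Support.

Theorem theorem9 (F1 F2 F3 : finIdomainType) (n1 n2 n3 : nat)
  (hn1 : #|[set x : F1 | x != 0%R]| = n1)
  (hn2 : #|[set x : F2 | x != 0%R]| = n2)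
  (hn3 : #|[set x : F3 | x != 0%R]| = n3)
  (h12 : n1 >= n2) (h23 : n2 >= n3) :
  alpha (zero_divisor_graph (F1 * F2 * F3)%type)
  = n1 * n2 + n1 * n3 + maxn n1 (n2 * n3).
Proof.
have n1_gt0 : 0 < n1 by rewrite -hn1 card_neq0_gt0.
have n3_gt0 : 0 < n3 by rewrite -hn3 card_neq0_gt0.
have weightE a b c : weight F1 F2 F3 (a, b, c)
    = (if a then n1 else 1) * (if b then n2 else 1) * (if c then n3 else 1).
  by rewrite /weight hn1 hn2 hn3.
apply/eqP; rewrite eqn_leq; apply/andP; split.
  apply/bigmax_leqP => A indA.
  rewrite card_sum_supp sum_bool3.
  rewrite (@supp_class_improper _ _ _ A (true, true, true)) //.
  rewrite (@supp_class_improper _ _ _ A (false, false, false)) // !cards0.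
  have := card_supp_class_compl (true, false, false) indA.
  have := card_supp_class_compl (false, true, false) indA.
  have := card_supp_class_compl (false, false, true) indA.
  rewrite /compl3 /= !weightE !mul1n !muln1.
  (* The ordering of the [n]s and their positivity settle two of the three pairs in favour of {1, 2}
     and {1, 3}; only {1} against {2, 3} stays open. *)
  have /maxn_idPr -> : n3 <= n1 * n2 by nia.
  have /maxn_idPr -> : n2 <= n1 * n3 by nia.
  lia.
(* The third support is {2, 3} or {1}, whichever class is larger. *)
rewrite maxnE; have [le1|/ltnW le2] := leqP n1 (n2 * n3).
  apply: leq_trans (alpha_ge_supp F1 F2 F3
    (S := [:: (true, true, false); (true, false, true); (false, true, true)])
    isT isT isT).
  by rewrite !big_cons big_nil !weightE; lia.
apply: leq_trans (alpha_ge_supp F1 F2 F3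
  (S := [:: (true, true, false); (true, false, true); (true, false, false)])
  isT isT isT).
by rewrite !big_cons big_nil !weightE; lia.
Qed.
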